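(* Let $V$ be a vector space over a field $\mathbb{F}$, let $n\ge 1$, and let $D:V^n\to\mathbb{F}$ be an $n$-determinant on $V$. Then $D$ is a multilinear function, i.e. $D$ is additive and homogeneous of degree $1$ in each of its $n$ variables separately (with the other variables held fixed).
   Context: Given a vector space $V$ over a field $\mathbb{F}$ and an integer $n\ge 1$, an $n$-determinant on $V$ is a function $D:V^n\to\mathbb{F}$ that is not identically zero, such that for all $v_1,\ldots,v_n,b\in V$ one has $$D(v_1,\ldots,v_n)\cdot b=\sum_{k=1}^n D(v_1,\ldots,v_{k-1},b,v_{k+1},\ldots,v_n)\cdot v_k,$$ and such that $V$ is not spanned by any $n-1$ vectors of $V$ (so that $V$ has dimension $n$ over $\mathbb{F}$). No linearity of $D$ is assumed in this definition. *)

(* Defs.v *)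
From HB Require Import structures.
From mathcomp Require Import all_boot all_order all_algebra.
Set Implicit Arguments.
Unset Strict Implicit.
Unset Printing Implicit Defensive.
Import GRing.Theory.
Local Open Scope ring_scope.

(* (v_1, ..., v_(k-1), b, v_(k+1), ..., v_n) *)
Definition replace (n : nat) (T : Type) (v : {ffun 'I_n -> T}) (k : 'I_n)
    (b : T) : {ffun 'I_n -> T} :=
  [ffun i => if i == k then b else v i].

Definition spans (F : fieldType) (V : lmodType F) (m : nat)
    (w : {ffun 'I_m -> V}) : Prop :=
  forall b : V, exists c : 'I_m -> F, b = \sum_(i < m) c i *: w i.

Record is_determinant (F : fieldType) (V : lmodType F) (n : nat)
    (D : {ffun 'I_n -> V} -> F) : Prop := IsDeterminant {
  determinant_nonzero : exists v : {ffun 'I_n -> V}, D v <> 0;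
  determinant_exchange : forall (v : {ffun 'I_n -> V}) (b : V),
    D v *: b = \sum_(k < n) D (replace v k b) *: v k;
  determinant_not_spanned : forall w : {ffun 'I_n.-1 -> V}, ~ spans w
}.

Definition is_multilinear (F : fieldType) (V : lmodType F) (n : nat)
    (D : {ffun 'I_n -> V} -> F) : Prop :=
  forall (k : 'I_n) (v : {ffun 'I_n -> V}),
    (forall x y : V,
      D (replace v k (x + y)) = D (replace v k x) + D (replace v k y)) /\
    (forall (a : F) (x : V),
      D (replace v k (a *: x)) = a * D (replace v k x)).

(* Main.v *)
(** If [D w <> 0], the exchange identity shows that [w] spans [V]; since [n - 1]
    vectors never span, [w] is linearly independent.  Fix all arguments but the
    [k]-th.  If [D] vanishes at all the values of the [k]-th argument involved,
    there is nothing to prove.  Otherwise they can be substituted into a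
    linearly independent family [w], and comparing the coefficients of [w k] in
    the exchange identity for [w] gives linearity. *)
Require Import Defs.
From HB Require Import structures.
From mathcomp Require Import all_boot all_order all_algebra.
Local Open Scope ring_scope.
Import GRing.Theory.

Lemma replace_replace (n : nat) (T : Type) (v : {ffun 'I_n -> T}) k x y :
  replace (replace v k x) k y = replace v k y.
Proof. by apply/ffunP => i; rewrite !ffunE; case: eqP. Qed.

Lemma spans_drop (F : fieldType) (V : lmodType F) (n : nat)
    (w : {ffun 'I_n.+1 -> V}) (c : 'I_n.+1 -> F) (k : 'I_n.+1) :
  spans w -> \sum_i c i *: w i = 0 -> c k != 0 ->
  spans [ffun i : 'I_n => w (lift k i)].
Proof.
move=> w_spans c_rel ck_neq0 b; have [e ->] := w_spans b.
(* Subtracting [e k / c k] times the relation from the expansion of [b] cancels the coefficient of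
   [w k]. *)
exists (fun i => e (lift k i) - e k / c k * c (lift k i)).
have -> : \sum_i e i *: w i = \sum_i (e i - e k / c k * c i) *: w i.
  under [RHS]eq_bigr => i _ do rewrite scalerBl -scalerA.
  by rewrite sumrB -scaler_sumr c_rel scaler0 subr0.
rewrite (bigD1_ord k) //= mulfVK // subrr scale0r add0r.
by apply: eq_bigr => i _; rewrite ffunE.
Qed.

Section Determinant.

Variables (F : fieldType) (V : lmodType F) (n : nat).
Variable D : {ffun 'I_n -> V} -> F.
Hypothesis hD : is_determinant D.

Lemma determinant_spans w : D w != 0 -> spans w.
Proof.
move=> Dw b; exists (fun k => (D w)^-1 * D (replace w k b)).
under eq_bigr => k _ do rewrite -scalerA.
by rewrite -scaler_sumr -(determinant_exchange hD) scalerA mulVf ?scale1r.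
Qed.

Lemma determinant_free w (c : 'I_n -> F) :
  D w != 0 -> \sum_i c i *: w i = 0 -> forall k, c k = 0.
Proof.
move=> Dw; have := determinant_spans w Dw; have := determinant_not_spanned hD.
(* Splitting [n] turns [n.-1] into [m]; for [n = 0] there is no index [k]. *)
clear; case: n w c => [|m] w c not_spanned w_spans c_rel k; first by case: k.
apply/eqP/negPn/negP => ck_neq0.
exact: not_spanned _ (spans_drop _ _ _ _ _ _ w_spans c_rel ck_neq0).
Qed.

Lemma determinant_linear_free w k : D w != 0 ->
  linear_for *%R (fun x => D (replace w k x)).
Proof.
move=> Dw a x y; apply: subr0_eq.
(* [c i] is the linearity defect in argument [i]; the exchange identities at [a *: x + y], [x] and
   [y] combine to a relation among the [w i] with these coefficients. *)
pose c i := D (replace w i (a *: x + y)) -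
  (a * D (replace w i x) + D (replace w i y)).
apply: (determinant_free w c Dw _ k).
under eq_bigr => i _ do rewrite scalerBl scalerDl -scalerA.
rewrite sumrB big_split -scaler_sumr -!(determinant_exchange hD) /=.
by rewrite scalerDr !scalerA mulrC subrr.
Qed.

Lemma determinant_linear v k : linear_for *%R (fun x => D (replace v k x)).
Proof.
(* The goal does not depend on [v k], so [v] may be traded for [replace v k u]. *)
have lin u : D (replace v k u) != 0 ->
    linear_for *%R (fun x => D (replace v k x)).
  move=> Du a x y; have := determinant_linear_free _ k Du a x y.
  by rewrite !replace_replace.
move=> a x y.
have [Dx|/lin] := eqVneq (D (replace v k x)) 0; last exact.
have [Dy|/lin] := eqVneq (D (replace v k y)) 0; last exact.
have [Dxy|/lin] := eqVneq (D (replace v k (a *: x + y))) 0; last exact.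
by rewrite Dx Dy Dxy mulr0 addr0.
Qed.

End Determinant.

Theorem proposition2p6 (F : fieldType) (V : lmodType F) (n : nat)
    (hn : (1 <= n)%N) (D : {ffun 'I_n -> V} -> F)
    (hD : is_determinant D) : is_multilinear D.
Proof.
move=> k v; have lin := determinant_linear _ _ _ _ hD v k.
have D0 : D (replace v k 0) = 0.
  (* At [a = -1] and zero vectors the right side cancels. *)
  by have := lin (-1) 0 0; rewrite scaler0 addr0 mulN1r addNr.
split=> [x y|a x]; first by have := lin 1 x y; rewrite scale1r mul1r.
by have := lin a x 0; rewrite D0 !addr0.
Qed.
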